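(* Let $R=\mathbf{k}\{x_1,\ldots,x_n;\,Q,Q',\preceq\}$ be a left PBW ring. Let $M$ be an $R$-bimodule with a finite presentation $0\to L\to R^m\xrightarrow{p_M}M\to 0$ of $R$-bimodules, and let $N$ be a finitely generated left $R$-module with a free resolution by left $R$-modules $$\cdots\xrightarrow{\partial_{k+1}}R^{s_k}\xrightarrow{\partial_k}R^{s_{k-1}}\to\cdots\xrightarrow{\partial_1}R^{s_0}\xrightarrow{\partial_0}N\to 0,$$ where for $k\ge 1$ the map $\partial_k$ is given by the matrix with rows $g_i^k=(g_{i1}^k,\ldots,g_{is_{k-1}}^k)\in R^{s_{k-1}}$, $1\le i\le s_k$. For $k\ge 0$ let $\pi_k:R^{ms_k}\to R^{ms_k}/L^{s_k}$ be the canonical projection. For $k\ge 1$ let $d_k:R^{ms_k}/L^{s_k}\to R^{ms_{k-1}}/L^{s_{k-1}}$ be the map $d_k=\gamma_{k-1}^{-1}\circ(1_M\otimes\partial_k)\circ\gamma_k$, and let $\widetilde{d_k}:R^{ms_k}\to R^{ms_{k-1}}$ be the left $R$-linear map given by the block matrix $A_k$ (the isomorphisms $\gamma_k$ and the matrices $A_k$ are defined in the context). Then for all $k\ge 1$: 1. $\ker d_k=\ker(\pi_{k-1}\widetilde{d_k})/L^{s_k}$. 2. $\operatorname{im} d_k=\operatorname{im}(\pi_{k-1}\widetilde{d_k})\subseteq R^{ms_{k-1}}/L^{s_{k-1}}$, and it is generated as a left $R$-module by $$\{(g_{i1}^k e'_j,\ldots,g_{is_{k-1}}^k e'_j)+L^{s_{k-1}}\;:\;1\le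 i\le s_k,\ 1\le j\le m\}$$ (where $(g_{i1}^k e'_j,\ldots,g_{is_{k-1}}^k e'_j)$ is the $(j+m(i-1))$-th row of $A_k$). 3. As left $R$-modules, $$\operatorname{Tor}_k(M,N)\cong\ker d_k/\operatorname{im} d_{k+1}=\ker(\pi_{k-1}\widetilde{d_k})\big/\big({}_R\langle\text{rows of }A_{k+1}\rangle+L^{s_k}\big).$$
   Context: Left PBW ring: $\mathbf{k}$ is a division ring contained in the ring $R$, $x_1,\ldots,x_n\in R$, and $\preceq$ is an admissible order on $\mathbb{N}^n$ (a total order compatible with addition and with least element $0$). The standard monomials $x^\alpha=x_1^{\alpha_1}\cdots x_n^{\alpha_n}$, $\alpha\in\mathbb{N}^n$, form a basis of $R$ as a left $\mathbf{k}$-vector space. For nonzero $f\in R$, $\exp(f)$ denotes the $\preceq$-largest $\alpha$ such that $x^\alpha$ occurs in $f$ with nonzero coefficient; $\epsilon_i$ is the $i$-th standard basis vector of $\mathbb{N}^n$. $Q$ is a set of relations $x_jx_i=q_{ji}x_ix_j+p_{ji}$ ($1\le i<j\le n$) holding in $R$, with $q_{ji}\in\mathbf{k}\setminus\{0\}$ and $p_{ji}\in R$ either $0$ or with $\exp(p_{ji})\prec\epsilon_i+\epsilon_j$. $Q'$ is a set of relations $x_ja=q_{ja}x_j+p_{ja}$ ($1\le j\le n$, $a\in\mathbf{k}\setminus\{0\}$) holding in $R$, with $q_{ja}\in\mathbf{k}\setminus\{0\}$ and $p_{ja}\in R$ either $0$ or with $\exp(p_{ja})\prec\epsilon_j$.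 Presentation of $M$: $R^m$ carries its componentwise $R$-bimodule structure, $p_M:R^m\to M$ is a surjective bimodule homomorphism with kernel the subbimodule $L\subseteq R^m$, and there is a finite set $H=\{h_1,\ldots,h_r\}\subseteq R^m$ with $L=RH=HR$, i.e. $H$ generates $L$ both as a left and as a right $R$-module. Since $M$ is a bimodule, $M\otimes_R N$ and $\operatorname{Tor}_k(M,N)=\operatorname{Tor}_k^R(M,N)$ are left $R$-modules; $\operatorname{Tor}_k(M,N)$ is the $k$-th homology of the complex $\cdots\to M\otimes_R R^{s_k}\xrightarrow{1_M\otimes\partial_k}M\otimes_R R^{s_{k-1}}\to\cdots\to M\otimes_R R^{s_0}\to 0$. Conventions: elements of free modules are row vectors, and a matrix represents the left $R$-linear map sending the $i$-th canonical basis vector to its $i$-th row (i.e. row vectors are multiplied by the matrix on the right). Let $\{e_1,\ldots,e_s\}$ and $\{e'_1,\ldots,e'_m\}$ be the canonical bases of $R^s$ and $R^m$. Identify $R^{ms}=(R^m)^s$, with canonical basis $e_{11},\ldots,e_{1m},\ldots,e_{s1},\ldots,e_{sm}$, where $e_{ij}=(0,\ldots,e'_j,\ldots,0)\in(R^m)^s$ has $e'_j$ in position $i$. Under this identification $L^s\subseteq(R^m)^s=R^{ms}$. For $k\ge0$, $\gamma_k:R^{ms_k}/L^{s_k}\to M\otimes_R R^{s_k}$ is the isomorphism of left $R$-modules determined by $e_{ij}+L^{s_k}\mapsto p_M(e'_j)\otimes e_i$ ($1\le i\le s_k$, $1\le j\le m$). For $k\ge1$, $A_k$ is the $ms_k\times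 ms_{k-1}$ matrix over $R$ built of $s_k\times s_{k-1}$ blocks of size $m\times m$, the $(i,l)$ block being $g_{il}^k I_m$, where $I_m$ is the $m\times m$ identity matrix. ${}_R\langle\cdot\rangle$ denotes the left $R$-submodule generated by the given elements. *)

(* Defs.v *)
From HB Require Import structures.
From mathcomp Require Import all_boot all_order all_algebra.
From mathcomp Require Import boolp.
From mathcomp Require Import freeg.
Set Implicit Arguments.
Unset Strict Implicit.
Unset Printing Implicit Defensive.
Import GRing.Theory.
Local Open Scope ring_scope.
Local Open Scope quotient_scope.

(* A submodule of [V] is a [submodClosed V].  As ambient predicates are
   boolean, submodules given by an existential formula use [`[< _ >]]. *)

Section Submodules.
Variable R : pzRingType.
Implicit Types U V W : lmodType R.

Definition ker_sub V W (f : {linear V -> W}) : {pred V} := fun v => f v == 0.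

Lemma ker_sub_closed V W (f : {linear V -> W}) : subsemimod_closed (ker_sub f).
Proof.
split; first split.
- by rewrite unfold_in linear0.
- by move=> u v; rewrite !unfold_in linearD => /eqP-> /eqP->; rewrite addr0.
- by move=> a v; rewrite !unfold_in linearZ_LR /= => /eqP->; rewrite scaler0.
Qed.
HB.instance Definition _ V W f :=
  GRing.isSubmodClosed.Build R V (@ker_sub V W f) (ker_sub_closed f).

Definition map_sub V W (f : {linear V -> W}) (A : submodClosed V) : {pred W} :=
  fun w => `[< exists2 v, v \in A & f v = w >].

Lemma map_sub_closed V W f A : subsemimod_closed (@map_sub V W f A).
Proof.
split; first split.
- by apply/asboolP; exists 0; rewrite ?rpred0 ?linear0.
- move=> _ _ /asboolP[u Au <-] /asboolP[v Av <-]; apply/asboolP.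
  by exists (u + v); rewrite ?rpredD ?linearD.
- move=> a _ /asboolP[v Av <-]; apply/asboolP.
  by exists (a *: v); rewrite ?rpredZ ?linearZ_LR.
Qed.
HB.instance Definition _ V W f A :=
  GRing.isSubmodClosed.Build R W (@map_sub V W f A) (map_sub_closed f A).

Definition full_sub V : {pred V} := fun=> true.
Lemma full_sub_closed V : subsemimod_closed (@full_sub V). Proof. by []. Qed.
HB.instance Definition _ V :=
  GRing.isSubmodClosed.Build R V (@full_sub V) (@full_sub_closed V).

Definition img_sub V W (f : {linear V -> W}) : {pred W} := map_sub f (@full_sub V).
HB.instance Definition _ V W f := GRing.SubmodClosed.on (@img_sub V W f).

Definition span_sub V (I : finType) (g : I -> V) : {pred V} :=
  fun v => `[< exists c : I -> R, v = \sum_i c i *: g i >].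

Lemma span_sub_closed V I g : subsemimod_closed (@span_sub V I g).
Proof.
split; first split.
- by apply/asboolP; exists (fun=> 0); rewrite big1 // => i; rewrite scale0r.
- move=> _ _ /asboolP[c ->] /asboolP[d ->]; apply/asboolP.
  exists (fun i => c i + d i); rewrite -big_split /=.
  by apply: eq_bigr => i _; rewrite scalerDl.
- move=> a _ /asboolP[c ->]; apply/asboolP; exists (fun i => a * c i).
  by rewrite scaler_sumr; apply: eq_bigr => i _; rewrite scalerA.
Qed.
HB.instance Definition _ V I g :=
  GRing.isSubmodClosed.Build R V (@span_sub V I g) (span_sub_closed g).

Definition sum_sub V (A B : submodClosed V) : {pred V} :=
  fun v => `[< exists a b, [/\ a \in A, b \in B & v = a + b] >].

Lemma sum_sub_closed V A B : subsemimod_closed (@sum_sub V A B).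
Proof.
split; first split.
- by apply/asboolP; exists 0, 0; rewrite !rpred0 addr0.
- move=> _ _ /asboolP[a [b [Aa Bb ->]]] /asboolP[c [d [Ac Bd ->]]].
  by apply/asboolP; exists (a + c), (b + d); rewrite !rpredD // addrACA.
- move=> r _ /asboolP[a [b [Aa Bb ->]]]; apply/asboolP.
  by exists (r *: a), (r *: b); rewrite !rpredZ // scalerDr.
Qed.
HB.instance Definition _ V A B :=
  GRing.isSubmodClosed.Build R V (@sum_sub V A B) (sum_sub_closed A B).

Definition zmod_of V (A : submodClosed V) : {pred V} := fun v => v \in A.
Lemma zmod_of_closed V A : zmod_closed (@zmod_of V A).
Proof. exact: GRing.submod_closedB (submodClosedP A). Qed.
HB.instance Definition _ V A :=
  GRing.isZmodClosed.Build V (@zmod_of V A) (zmod_of_closed A).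

Definition submod V (A : submodClosed V) : Type := {v : V | v \in A}.
HB.instance Definition _ V A := SubChoice.on (@submod V A).
HB.instance Definition _ V A :=
  [SubChoice_isSubLmodule of @submod V A by <:].

Definition quomod V (A : submodClosed V) : Type :=
  Quotient.quot (zmod_of A : zmodClosed V).
HB.instance Definition _ V A := ZmodQuotient.on (@quomod V A).

Definition proj V (A : submodClosed V) (v : V) : quomod A := \pi_(quomod A) v.

Lemma proj_eqP V (A : submodClosed V) (u v : V) :
  (proj A u = proj A v) <-> (u - v \in A).
Proof.
split; last by move=> uvA; apply/eqP; rewrite -Quotient.idealrBE.
by move/eqP; rewrite -Quotient.idealrBE.
Qed.

Lemma reprojK V (A : submodClosed V) (q : quomod A) : proj A (repr q) = q.
Proof. exact: reprK. Qed.

Lemma proj_is_zmod_morphism V A : zmod_morphism (@proj V A).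
Proof. by move=> u v; rewrite /proj raddfB. Qed.
HB.instance Definition _ V A :=
  GRing.isZmodMorphism.Build V (quomod A) (@proj V A)
    (@proj_is_zmod_morphism V A).

Section QuoScale.
Variables (V : lmodType R) (A : submodClosed V).
Definition quo_scale (a : R) (q : quomod A) : quomod A := proj A (a *: repr q).

Lemma quo_scale_proj a v : quo_scale a (proj A v) = proj A (a *: v).
Proof. by apply/proj_eqP; rewrite -scalerBr rpredZ //; apply/proj_eqP/reprojK. Qed.

Lemma quo_scaleA a b q : quo_scale a (quo_scale b q) = quo_scale (a * b) q.
Proof. by rewrite -[q]reprojK !quo_scale_proj scalerA. Qed.
Lemma quo_scale1 : left_id 1 quo_scale.
Proof. by move=> q; rewrite -[q]reprojK quo_scale_proj scale1r. Qed.
Lemma quo_scaleDr : right_distributive quo_scale +%R.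
Proof.
move=> a q r; rewrite -[q]reprojK -[r]reprojK -raddfD !quo_scale_proj.
by rewrite scalerDr raddfD.
Qed.
Lemma quo_scaleDl q : {morph quo_scale^~ q : a b / a + b}.
Proof. by move=> a b; rewrite -[q]reprojK !quo_scale_proj scalerDl raddfD. Qed.
End QuoScale.
HB.instance Definition _ V A := GRing.Zmodule_isLmodule.Build R (@quomod V A)
  (@quo_scaleA V A) (@quo_scale1 V A) (@quo_scaleDr V A) (@quo_scaleDl V A).

Lemma proj_is_scalable V A : scalable (@proj V A).
Proof. by move=> a v; rewrite -quo_scale_proj. Qed.
HB.instance Definition _ V A :=
  GRing.isScalable.Build R V (quomod A) _ (@proj V A) (@proj_is_scalable V A).

(* [A / B] inside [V / B], that is the image of [A] under the projection. *)
Definition quo_sub V (A B : submodClosed V) : submodClosed (quomod B) :=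
  map_sub (proj B) A.

(* The module [A / B] for submodules [B <= A] of [V] (in general this is
   [A / (A :&: B)]). *)
Definition trace_sub V (A B : submodClosed V) : {pred submod A} :=
  fun v => val v \in B.
Arguments trace_sub {V} A B.
Lemma trace_sub_closed V A B : subsemimod_closed (@trace_sub V A B).
Proof.
split; first split.
- by rewrite -topredE /= /trace_sub raddf0 rpred0.
- move=> u v Bu Bv; rewrite -topredE /= /trace_sub raddfD; exact: rpredD.
- move=> a v Bv; rewrite -topredE /= /trace_sub linearZ_LR; exact: rpredZ.
Qed.
HB.instance Definition _ V A B :=
  GRing.isSubmodClosed.Build R (submod A) (@trace_sub V A B)
    (trace_sub_closed A B).
Definition subquo V (A B : submodClosed V) : lmodType R :=
  quomod (trace_sub A B).

Definition class_of V (A B : submodClosed V) (v : submod A) : subquo A B :=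
  proj (trace_sub A B) v.

Arguments class_of {V} A B v.

Definition lmod_iso V W : Prop := exists f : {linear V -> W}, bijective f.

Definition fin_gen V : Prop :=
  exists (r : nat) (g : 'I_r -> V), forall v, v \in span_sub g.

Section LinearInverse.
Variables (V W : lmodType R) (f : {linear V -> W}) (fbij : bijective f).

Lemma lin_inv_ex w : exists v, f v == w.
Proof. by case: fbij => g _ gK; exists (g w); rewrite gK. Qed.
Definition lin_inv (w : W) : V := xchoose (lin_inv_ex w).
Lemma lin_invK : cancel lin_inv f.
Proof. by move=> w; apply/eqP/(xchooseP (lin_inv_ex w)). Qed.
Lemma lin_invE : cancel f lin_inv.
Proof. by move=> v; apply: (bij_inj fbij); rewrite lin_invK. Qed.
Lemma lin_inv_is_linear : linear lin_inv.
Proof.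
by move=> a u v; apply: (bij_inj fbij); rewrite linearP !lin_invK.
Qed.
HB.instance Definition _ := GRing.isLinear.Build R W V _ lin_inv lin_inv_is_linear.
End LinearInverse.

End Submodules.

HB.mixin Record Lmodule_isBimodule (R : pzRingType) M of GRing.Lmodule R M := {
  rscale : M -> R -> M;
  rscaleA : forall v a b, rscale (rscale v a) b = rscale v (a * b);
  rscale1 : right_id 1 rscale;
  rscaleDl : forall a, {morph rscale^~ a : u v / u + v};
  rscaleDr : forall v, {morph rscale v : a b / a + b};
  scale_rscaleA : forall a v b, a *: rscale v b = rscale (a *: v) b
}.
#[short(type="bimodType")]
HB.structure Definition Bimodule (R : pzRingType) :=
  {M of GRing.Lmodule R M & Lmodule_isBimodule R M}.

Notation "v :* a" := (rscale v a) : ring_scope.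

Section FreeBimodule.
Variables (R : pzRingType) (m n : nat).
Implicit Types (A : 'M[R]_(m, n)) (a b : R).
Definition mx_rscale A a : 'M[R]_(m, n) := \matrix_(i, j) (A i j * a).
Lemma mx_rscaleA A a b : mx_rscale (mx_rscale A a) b = mx_rscale A (a * b).
Proof. by apply/matrixP => i j; rewrite !mxE mulrA. Qed.
Lemma mx_rscale1 : right_id 1 mx_rscale.
Proof. by move=> A; apply/matrixP => i j; rewrite !mxE mulr1. Qed.
Lemma mx_rscaleDl a : {morph mx_rscale^~ a : A B / A + B}.
Proof. by move=> A B; apply/matrixP => i j; rewrite !mxE mulrDl. Qed.
Lemma mx_rscaleDr A : {morph mx_rscale A : a b / a + b}.
Proof. by move=> a b; apply/matrixP => i j; rewrite !mxE mulrDr. Qed.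
Lemma mx_scale_rscaleA a A b : a *: mx_rscale A b = mx_rscale (a *: A) b.
Proof. by apply/matrixP => i j; rewrite !mxE mulrA. Qed.
HB.instance Definition _ := Lmodule_isBimodule.Build R 'M[R]_(m, n)
  mx_rscaleA mx_rscale1 mx_rscaleDl mx_rscaleDr mx_scale_rscaleA.
End FreeBimodule.

Definition right_linear (R : pzRingType) (M N : bimodType R) (f : M -> N) :=
  forall v a, f (v :* a) = f v :* a.

(* [M (x)_R N] is the free abelian group on [M * N] modulo the subgroup
   [tensor_rel] generated by the usual relations. *)

Section Tensor.
Variables (R : pzRingType) (M : bimodType R) (N : lmodType R).

Local Notation FMN := {freeg (M * N)%type / int}.
Local Notation bas m n := (<< (m, n) >> : FMN).

Inductive tensor_rel_gen : FMN -> Prop :=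
| tensor_relB x y :
    tensor_rel_gen x -> tensor_rel_gen y -> tensor_rel_gen (x - y)
| tensor_relDl m1 m2 n :
    tensor_rel_gen (bas (m1 + m2) n - bas m1 n - bas m2 n)
| tensor_relDr m n1 n2 :
    tensor_rel_gen (bas m (n1 + n2) - bas m n1 - bas m n2)
| tensor_relA m a n : tensor_rel_gen (bas (m :* a) n - bas m (a *: n)).

Definition tensor_rel : {pred FMN} := fun x => `[< tensor_rel_gen x >].
Lemma tensor_rel_closed : zmod_closed tensor_rel.
Proof.
split=> [|x y /asboolP hx /asboolP hy]; last exact/asboolP/tensor_relB.
apply/asboolP; have h := tensor_relDl 0 0 0.
by have := tensor_relB h h; rewrite subrr.
Qed.
HB.instance Definition _ := GRing.isZmodClosed.Build FMN tensor_rel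
  tensor_rel_closed.

Definition tensor : Type := Quotient.quot (tensor_rel : zmodClosed FMN).
HB.instance Definition _ := ZmodQuotient.on tensor.

Definition tensor_pi (x : FMN) : tensor := \pi_tensor x.
Lemma tensor_pi_is_zmod_morphism : zmod_morphism tensor_pi.
Proof. by move=> x y; rewrite /tensor_pi raddfB. Qed.
HB.instance Definition _ :=
  GRing.isZmodMorphism.Build FMN tensor tensor_pi tensor_pi_is_zmod_morphism.

Lemma tensor_piP x y : tensor_pi x = tensor_pi y <-> tensor_rel_gen (x - y).
Proof.
split=> [/eqP|h]; first by rewrite -Quotient.idealrBE => /asboolP.
by apply/eqP; rewrite -Quotient.idealrBE; apply/asboolP.
Qed.

Definition tens (m : M) (n : N) : tensor := tensor_pi (bas m n).

Lemma tensDl m1 m2 n : tens (m1 + m2) n = tens m1 n + tens m2 n.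
Proof.
rewrite -raddfD; apply/tensor_piP; rewrite opprD addrA; exact: tensor_relDl.
Qed.
Lemma tensDr m n1 n2 : tens m (n1 + n2) = tens m n1 + tens m n2.
Proof.
rewrite -raddfD; apply/tensor_piP; rewrite opprD addrA; exact: tensor_relDr.
Qed.
Lemma tensA m a n : tens (m :* a) n = tens m (a *: n).
Proof. by apply/tensor_piP; apply: tensor_relA. Qed.

Lemma tens0l n : tens 0 n = 0.
Proof. by apply: (addrI (tens 0 n)); rewrite -tensDl !addr0. Qed.
Lemma tens0r m : tens m 0 = 0.
Proof. by apply: (addrI (tens m 0)); rewrite -tensDr !addr0. Qed.
Lemma tens_suml I (r : seq I) (f : I -> M) n :
  tens (\sum_(i <- r) f i) n = \sum_(i <- r) tens (f i) n.
Proof.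
exact: (big_morph (fun m => tens m n) (fun m1 m2 => tensDl m1 m2 n) (tens0l n)).
Qed.
Lemma tens_sumr I (r : seq I) m (f : I -> N) :
  tens m (\sum_(i <- r) f i) = \sum_(i <- r) tens m (f i).
Proof. exact: (big_morph (tens m) (tensDr m) (tens0r m)). Qed.

Section Lift.
Variables (Z : zmodType) (f : M -> N -> Z).

Definition balanced := [/\ forall m1 m2 n, f (m1 + m2) n = f m1 n + f m2 n,
  forall m n1 n2, f m (n1 + n2) = f m n1 + f m n2 &
  forall m a n, f (m :* a) n = f m (a *: n)].

Definition fglift_pair (x : FMN) : Z :=
  fglift (fun u => f u.1 u.2 : zmodule Z) x.
Lemma fglift_pairB : zmod_morphism fglift_pair.
Proof. exact: (@lift_is_additive int _ (zmodule Z)). Qed.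
HB.instance Definition _ :=
  GRing.isZmodMorphism.Build FMN Z fglift_pair fglift_pairB.
Lemma fglift_pair_bas m n : fglift_pair (bas m n) = f m n.
Proof. by rewrite /fglift_pair liftU. Qed.

(* The additive map [m (x) n |-> f m n], for a balanced [f]. *)
Definition tensor_lift (t : tensor) : Z := fglift_pair (repr t).

Hypothesis f_bal : balanced.

Lemma tensor_lift_pi x : tensor_lift (tensor_pi x) = fglift_pair x.
Proof.
have [fDl fDr fA] := f_bal.
apply/eqP; rewrite -subr_eq0 -raddfB; apply/eqP.
have: tensor_rel_gen (repr (tensor_pi x) - x) by apply/tensor_piP/reprK.
elim=> [y z _ hy _ hz|m1 m2 n|m n1 n2|m a n].
- by rewrite raddfB hy hz subrr.
- by rewrite !raddfB /= !fglift_pair_bas fDl -addrA -opprD subrr.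
- by rewrite !raddfB /= !fglift_pair_bas fDr -addrA -opprD subrr.
- by rewrite raddfB /= !fglift_pair_bas fA subrr.
Qed.
Lemma tensor_liftE m n : tensor_lift (tens m n) = f m n.
Proof. by rewrite /tens tensor_lift_pi fglift_pair_bas. Qed.
Lemma tensor_liftD : {morph tensor_lift : t u / t + u}.
Proof.
move=> t u; rewrite -[t]reprK -[u]reprK -!/(tensor_pi _) -raddfD.
by rewrite !tensor_lift_pi raddfD.
Qed.
End Lift.

Lemma tensor_gen (t : tensor) : exists s : seq (M * N), t = \sum_(u <- s) tens u.1 u.2.
Proof.
have tensN m n : - tens m n = tens (- m) n.
  by apply/(addrI (tens m n)); rewrite -tensDl !subrr tens0l.
pose P (t : tensor) := exists s : seq (M * N), t = \sum_(u <- s) tens u.1 u.2.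
have P0 : P 0 by exists [::]; rewrite big_nil.
have PD t1 t2 : P t1 -> P t2 -> P (t1 + t2).
  by move=> [s1 ->] [s2 ->]; exists (s1 ++ s2); rewrite big_cat.
have PN t1 : P t1 -> P (- t1).
  move=> [s ->]; exists [seq (- u.1, u.2) | u <- s].
  by rewrite big_map -sumrN; apply: eq_bigr => u _; rewrite tensN.
have Pn t1 k : P t1 -> P (t1 *+ k).
  by move=> Pt; elim: k => [|k IH]; rewrite ?mulr0n // mulrS; apply: PD.
have -> : t = tensor_pi (repr t) by rewrite /tensor_pi reprK.
rewrite -[repr t]freeg_sumE raddf_sum; apply: (big_ind P) => // -[m n] _.
have -> : <<coeff (m, n) (repr t) *g (m, n)>> = (bas m n) *~ coeff (m, n) (repr t).
  by rewrite freegU_mulz intz.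
rewrite raddfMz; have Pt : P (tensor_pi (bas m n)).
  by exists [:: (m, n)]; rewrite big_seq1.
by case: (coeff _ _) => k; [apply: Pn|apply/PN/Pn].
Qed.

Lemma tensor_ext (Z : zmodType) (f g : tensor -> Z) :
    {morph f : t u / t + u} -> {morph g : t u / t + u} ->
  (forall m n, f (tens m n) = g (tens m n)) -> f =1 g.
Proof.
have mor0 (h : tensor -> Z) : {morph h : t u / t + u} -> h 0 = 0.
  by move=> hD; apply: (addrI (h 0)); rewrite -hD !addr0.
move=> fD gD fg t; have [s ->] := tensor_gen t.
by elim: s => [|u s IH]; rewrite ?big_nil ?mor0 // !big_cons fD gD IH fg.
Qed.

(* The left action [a *: (m (x) n) = (a *: m) (x) n]. *)
Definition tensor_scale (a : R) : tensor -> tensor :=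
  tensor_lift (fun m n => tens (a *: m) n).
Lemma tensor_scale_bal a : balanced (fun m n => tens (a *: m) n).
Proof.
split=> *; first by rewrite scalerDr tensDl.
- by rewrite tensDr.
- by rewrite scale_rscaleA tensA.
Qed.
Lemma tensor_scaleE a m n : tensor_scale a (tens m n) = tens (a *: m) n.
Proof. exact/tensor_liftE/tensor_scale_bal. Qed.
Lemma tensor_scaleDr : right_distributive tensor_scale +%R.
Proof. by move=> a; apply/tensor_liftD/tensor_scale_bal. Qed.
Lemma tensor_scaleA a b t :
  tensor_scale a (tensor_scale b t) = tensor_scale (a * b) t.
Proof.
move: t; apply: tensor_ext => [t u|t u|m n]; rewrite ?tensor_scaleDr //.
by rewrite !tensor_scaleE scalerA.
Qed.
Lemma tensor_scale1 : left_id 1 tensor_scale.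
Proof.
apply: tensor_ext => [t u|t u|m n] //; rewrite ?tensor_scaleDr //.
by rewrite !tensor_scaleE scale1r.
Qed.
Lemma tensor_scaleDl t : {morph tensor_scale^~ t : a b / a + b}.
Proof.
move=> a b; move: t; apply: tensor_ext => [t u|t u|m n].
- by rewrite tensor_scaleDr.
- by rewrite !tensor_scaleDr addrACA.
- by rewrite !tensor_scaleE scalerDl tensDl.
Qed.
HB.instance Definition _ := GRing.Zmodule_isLmodule.Build R tensor
  tensor_scaleA tensor_scale1 tensor_scaleDr tensor_scaleDl.

Lemma tensZl a m n : a *: tens m n = tens (a *: m) n.
Proof. exact: tensor_scaleE. Qed.
End Tensor.

Arguments tens {R M N} m n.

Section TensorMap.
Variables (R : pzRingType) (M : bimodType R) (N N' : lmodType R).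
Variable f : {linear N -> N'}.

(* [1_M (x) f] *)
Definition tensor_map : tensor M N -> tensor M N' :=
  tensor_lift (fun m n => tens m (f n)).
Lemma tensor_map_bal : balanced (fun (m : M) n => tens m (f n)).
Proof.
split=> *; first by rewrite tensDl.
- by rewrite linearD tensDr.
- by rewrite tensA linearZ_LR.
Qed.
Lemma tensor_mapE m n : tensor_map (tens m n) = tens m (f n).
Proof. exact/tensor_liftE/tensor_map_bal. Qed.
Lemma tensor_map_is_linear : linear tensor_map.
Proof.
have fD : {morph tensor_map : t u / t + u} by apply/tensor_liftD/tensor_map_bal.
move=> a t u; rewrite fD; congr (_ + _).
move: t; apply: tensor_ext => [v w|v w|m n]; rewrite ?scalerDr ?fD ?scalerDr //.
by rewrite tensZl !tensor_mapE tensZl.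
Qed.
HB.instance Definition _ := GRing.isLinear.Build R (tensor M N) (tensor M N')
  _ tensor_map tensor_map_is_linear.
End TensorMap.

Arguments tensor_map {R} M {N N'} f t.

Definition exponent (n : nat) := {ffun 'I_n -> nat}.
Definition epsilon n (i : 'I_n) : exponent n := [ffun j => (j == i) : nat].

Record admissible n (le : rel (exponent n)) : Prop := Admissible {
  adm_refl : reflexive le;
  adm_anti : antisymmetric le;
  adm_trans : transitive le;
  adm_total : total le;
  adm_add : forall a b c, le a b -> le (a + c) (b + c);
  adm_0 : forall a, le 0 a
}.

Section LeftPBW.
Variables (R : nzRingType) (n : nat).

Definition division_subring (K : {pred R}) : Prop :=
  subring_closed K /\
  forall a, a \in K -> a != 0 -> exists2 b, b \in K & a * b = 1 /\ b * a = 1.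

(* The factors are taken in increasing order of [i]. *)
Definition std_monomial (x : 'I_n -> R) (a : exponent n) : R :=
  \prod_(i < n) x i ^+ a i.

(* [f] is the left [K]-linear combination of the standard monomials with
   (distinct) exponents in [s] and coefficients [c]. *)
Definition std_expansion (K : {pred R}) (x : 'I_n -> R)
    (s : seq (exponent n)) (c : exponent n -> R) (f : R) : Prop :=
  [/\ uniq s, forall a, c a \in K & f = \sum_(a <- s) c a * std_monomial x a].

Definition std_basis (K : {pred R}) (x : 'I_n -> R) : Prop :=
  (forall f, exists s c, std_expansion K x s c f) /\
  (forall s c, std_expansion K x s c 0 -> forall a, a \in s -> c a = 0).

(* [is_exp K x le f a] means [exp(f) = a]; it entails [f != 0] when the
   standard monomials are linearly independent. *)
Definition is_exp (K : {pred R}) (x : 'I_n -> R) (le : rel (exponent n))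
    (f : R) (a : exponent n) : Prop :=
  exists s c, [/\ std_expansion K x s c f, a \in s, c a != 0 &
                  forall b, b \in s -> c b != 0 -> le b a].

Definition zero_or_exp_lt (K : {pred R}) (x : 'I_n -> R)
    (le : rel (exponent n)) (f : R) (b : exponent n) : Prop :=
  f = 0 \/ exists2 a, is_exp K x le f a & le a b && (a != b).

(* The structure R = k{x_1, ..., x_n; Q, Q', <=} of a left PBW ring on [R];
   [q j i], [p j i] are only relevant for [i < j], and [q' j a], [p' j a] for
   [a] nonzero in [k]. *)
Record left_pbw_ring := LeftPBWRing {
  pbw_k : {pred R};
  pbw_x : 'I_n -> R;
  pbw_le : rel (exponent n);
  pbw_q : 'I_n -> 'I_n -> R;
  pbw_p : 'I_n -> 'I_n -> R;
  pbw_q' : 'I_n -> R -> R;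
  pbw_p' : 'I_n -> R -> R;
  pbw_k_division : division_subring pbw_k;
  pbw_le_admissible : admissible pbw_le;
  pbw_std_basis : std_basis pbw_k pbw_x;
  pbw_Q : forall i j : 'I_n, (i < j)%N ->
    [/\ pbw_x j * pbw_x i = pbw_q j i * pbw_x i * pbw_x j + pbw_p j i,
        pbw_q j i \in pbw_k, pbw_q j i != 0 &
        zero_or_exp_lt pbw_k pbw_x pbw_le (pbw_p j i) (epsilon i + epsilon j)];
  pbw_Q' : forall (j : 'I_n) a, a \in pbw_k -> a != 0 ->
    [/\ pbw_x j * a = pbw_q' j a * pbw_x j + pbw_p' j a,
        pbw_q' j a \in pbw_k, pbw_q' j a != 0 &
        zero_or_exp_lt pbw_k pbw_x pbw_le (pbw_p' j a) (epsilon j)]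
}.
End LeftPBW.

(* The last two fields say that the kernel [L] of [p_M] is [R H = H R]. *)
Record bimod_presentation (R : pzRingType) (M : bimodType R) (m : nat) :=
    BimodPresentation {
  pres_p : {linear 'rV[R]_m -> M};
  pres_p_right : right_linear pres_p;
  pres_p_surj : forall y, exists v, pres_p v = y;
  pres_r : nat;
  pres_H : 'I_pres_r -> 'rV[R]_m;
  pres_RH : forall v, v \in ker_sub pres_p <->
    exists c : 'I_pres_r -> R, v = \sum_i c i *: pres_H i;
  pres_HR : forall v, v \in ker_sub pres_p <->
    exists c : 'I_pres_r -> R, v = \sum_i pres_H i :* c i
}.

(* [res_d k] is the matrix of the map numbered [k.+1]; it acts on row vectors
   by multiplication on the right. *)
Record free_resolution (R : pzRingType) (N : lmodType R) := FreeResolution {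
  res_s : nat -> nat;
  res_d : forall k, 'M[R]_(res_s k.+1, res_s k);
  res_d0 : {linear 'rV[R]_(res_s 0) -> N};
  res_surj : forall y, exists v, res_d0 v = y;
  res_exact0 : ker_sub res_d0 =i img_sub (mulmxr (res_d 0));
  res_exact : forall k,
    ker_sub (mulmxr (res_d k) : {linear 'rV_(_) -> 'rV_(_)})
      =i img_sub (mulmxr (res_d k.+1))
}.

Section Tor.
Variables (R : pzRingType) (M : bimodType R) (N : lmodType R).
Variable F : free_resolution N.

Definition res_map k : {linear 'rV[R]_(res_s F k.+1) -> 'rV[R]_(res_s F k)} :=
  mulmxr (res_d F k).

(* [1_M (x) d], in homological degree [k.+1]. *)
Definition tor_map k : {linear tensor M 'rV[R]_(res_s F k.+1) ->
                               tensor M 'rV[R]_(res_s F k)} :=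
  tensor_map M (res_map k).

Definition tor_cycles k : submodClosed (tensor M 'rV[R]_(res_s F k)) :=
  match k with
  | 0 => @full_sub R _
  | k'.+1 => ker_sub (tor_map k')
  end.

(* The homology of [M (x) F], computed from the given resolution of [N]. *)
Definition Tor k : lmodType R :=
  subquo (tor_cycles k) (img_sub (tor_map k)).
End Tor.

(* [R^{ms} = (R^m)^s] is realised as row vectors made of [s] blocks of size
   [m], see [mxrow] and [submxrow]. *)
Notation block_rV R m s := 'rV[R]_(\sum_(i < s) m).

Section Complex.
Variables (R : pzRingType) (M : bimodType R) (m : nat).
Variable P : bimod_presentation M m.

Definition pres_L : submodClosed 'rV[R]_m := ker_sub (pres_p P).

(* [L^s] *)
Definition pres_Ls s : {pred block_rV R m s} :=
  fun v => [forall i, submxrow v i \in pres_L].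
Arguments pres_Ls s v : clear implicits.
Lemma pres_Ls_closed s : subsemimod_closed (pres_Ls s).
Proof.
split; first split.
- by apply/forallP => i; rewrite submxrow0 rpred0.
- move=> u v /forallP uL /forallP vL; apply/forallP => i.
  by rewrite submxrowD rpredD.
- move=> a v /forallP vL; apply/forallP => i.
  have -> : submxrow (a *: v) i = a *: submxrow v i.
    by apply/rowP => j; rewrite !mxE.
  exact: rpredZ.
Qed.
HB.instance Definition _ s :=
  GRing.isSubmodClosed.Build R (block_rV R m s) (pres_Ls s) (pres_Ls_closed s).

(* [e_ij] *)
Definition block_delta s (i : 'I_s) (j : 'I_m) : block_rV R m s :=
  \mxrow_(l < s) (if l == i then delta_mx 0 j else 0).

(* [gamma] is determined by [e_ij + L^s |-> p_M(e'_j) (x) e_i], see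
   [gamma_block_delta]; it is bijective by [gamma_bij]. *)
Definition gamma_pre s (v : block_rV R m s) : tensor M 'rV[R]_s :=
  \sum_(i < s) \sum_(j < m)
    submxrow v i 0 j *: tens (pres_p P (delta_mx 0 j)) (delta_mx 0 i).
Definition gamma s (q : quomod (pres_Ls s)) : tensor M 'rV[R]_s :=
  gamma_pre (repr q).

Lemma gamma_preE s (v : block_rV R m s) :
  gamma_pre v = \sum_(i < s) tens (pres_p P (submxrow v i)) (delta_mx 0 i).
Proof.
apply: eq_bigr => i _; rewrite [X in pres_p P X]row_sum_delta linear_sum.
rewrite tens_suml; apply: eq_bigr => j _; by rewrite linearZ_LR tensZl.
Qed.

Lemma gamma_pre_is_linear s : linear (@gamma_pre s).
Proof.
move=> a u v; rewrite !gamma_preE scaler_sumr -big_split /=.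
apply: eq_bigr => i _; rewrite tensZl -tensDl -linearP; congr (tens (pres_p P _) _).
by apply/rowP => j; rewrite !mxE.
Qed.
HB.instance Definition _ s := GRing.isLinear.Build R (block_rV R m s)
  (tensor M 'rV[R]_s) _ (@gamma_pre s) (@gamma_pre_is_linear s).

Lemma gamma_proj s v : gamma (proj (pres_Ls s) v) = gamma_pre v.
Proof.
apply/eqP; rewrite -subr_eq0 -linearB /= gamma_preE big1 // => i _.
have /forallP/(_ i)/eqP -> : repr (proj (pres_Ls s) v) - v \in pres_Ls s.
  exact/proj_eqP/reprojK.
exact: tens0l.
Qed.

Lemma gamma_is_linear s : linear (@gamma s).
Proof.
move=> a q r; rewrite -[q]reprojK -[r]reprojK -linearP.
by rewrite !gamma_proj linearP.
Qed.
HB.instance Definition _ s := GRing.isLinear.Build R (quomod (pres_Ls s))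
  (tensor M 'rV[R]_s) _ (@gamma s) (@gamma_is_linear s).

Lemma gamma_block_delta s i j : gamma (proj (pres_Ls s) (block_delta i j)) =
  tens (pres_p P (delta_mx 0 j)) (delta_mx 0 i).
Proof.
rewrite gamma_proj gamma_preE (bigD1 i) //= big1 ?addr0.
  by rewrite mxrowK eqxx.
by move=> l li; rewrite mxrowK (negPf li) linear0 tens0l.
Qed.

Lemma gamma_bij s : bijective (@gamma s).
Proof.
pose cf (x : M) (v : 'rV[R]_s) : {ffun 'I_s -> M} := [ffun i => x :* v 0 i].
have r0 (x : M) : x :* 0 = 0 by apply: (addrI (x :* 0)); rewrite -rscaleDr !addr0.
have cf_bal : balanced cf.
  split=> *; apply/ffunP => i; rewrite !ffunE ?rscaleDl ?mxE ?rscaleDr //.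
  by rewrite rscaleA.
have cfD := tensor_liftD cf_bal.
have inj : injective (@gamma s).
  move=> q r /eqP; rewrite -subr_eq0 -linearB => /eqP.
  rewrite /= -[q - r]reprojK gamma_proj gamma_preE => h.
  apply/eqP; rewrite -subr_eq0 -[q - r]reprojK -(linear0 (proj (pres_Ls s))).
  apply/eqP/proj_eqP; rewrite subr0; move: (repr (q - r)) h => v h.
  apply/forallP => i; apply/eqP.
  have /ffunP/(_ i) := congr1 (tensor_lift cf) h.
  have cf0 : tensor_lift cf 0 = 0.
    by apply: (addrI (tensor_lift cf 0)); rewrite -cfD !addr0.
  rewrite (big_morph _ cfD cf0) cf0 sum_ffunE ffunE (bigD1 i) //= big1 ?addr0.
    by rewrite tensor_liftE // ffunE mxE !eqxx rscale1.
  by move=> l li; rewrite tensor_liftE // ffunE mxE eq_sym (negPf li) andbF r0.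
have surj (t : tensor M 'rV[R]_s) : exists q, gamma q == t.
  have [w ->] := tensor_gen t.
  elim: w => [|[x v] w [q /eqP IH]].
    by exists 0; rewrite linear0 big_nil.
  have ex i : exists u : 'rV[R]_m, pres_p P u == x :* v 0 i.
    by have [u <-] := pres_p_surj P (x :* v 0 i); exists u.
  exists (proj (pres_Ls s) (\mxrow_i xchoose (ex i)) + q).
  rewrite big_cons linearD -IH /= gamma_proj gamma_preE; apply/eqP; congr (_ + _).
  rewrite [v in RHS]row_sum_delta tens_sumr; apply: eq_bigr => i _.
  by rewrite mxrowK (eqP (xchooseP (ex i))) tensA.
exists (fun t => xchoose (surj t)) => [q|t]; last exact/eqP/(xchooseP (surj t)).
exact/inj/eqP/(xchooseP (surj _)).
Qed.

Variables (N : lmodType R) (F : free_resolution N).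

(* The map [d_(k+1)], namely gamma_k^-1 o (1_M (x) d_(k+1)) o gamma_(k+1). *)
Definition quo_d k : {linear quomod (pres_Ls (res_s F k.+1)) ->
                         quomod (pres_Ls (res_s F k))} :=
  lin_inv (@gamma_bij (res_s F k)) \o tor_map M F k
    \o @gamma (res_s F k.+1).

(* The matrix [A_(k+1)], with blocks [g_il I_m]. *)
Definition matA k :
    'M[R]_(\sum_(i < res_s F k.+1) m, \sum_(l < res_s F k) m) :=
  \mxblock_(i < res_s F k.+1, l < res_s F k) ((res_d F k i l)%:M : 'M[R]_m).

Definition dtilde k : {linear block_rV R m (res_s F k.+1) ->
                              block_rV R m (res_s F k)} :=
  mulmxr (matA k).

Definition proj_dtilde k : {linear block_rV R m (res_s F k.+1) ->
                                   quomod (pres_Ls (res_s F k))} :=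
  proj (pres_Ls (res_s F k)) \o dtilde k.
End Complex.

Arguments pres_Ls {R M m} P s v.

(* Main.v *)
Require Import Defs.
From HB Require Import structures.
From mathcomp Require Import all_boot all_order all_algebra.
From mathcomp Require Import boolp.
Set Implicit Arguments.
Unset Strict Implicit.
Unset Printing Implicit Defensive.
Import GRing.Theory.
Local Open Scope ring_scope.

(** The quotient [R^{ms} / L^s] is [M (x) R^s] in disguise, by way of [gamma],
    so [d = gamma^-1 o (1 (x) delta) o gamma] is the differential of the
    complex computing [Tor].  Everything rests on one identity,
    [d o pi = pi o dtilde] ([quo_d_proj]): the matrix [A] computes [d] on
    representatives.  To see it, write a class in [M (x) R^s] as
    [\sum_i p_M(v_i) (x) e_i]; as [delta e_i = \sum_l g_il e_l] and the tensor
    product is balanced over [R], [1 (x) delta] sends it to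
    [\sum_l p_M(\sum_i v_i g_il) (x) e_l].  It is essential here that [p_M] is
    also right linear; the block [g_il I_m] of [A] is exactly the right
    multiplication of the row vector [v_i] by [g_il].

    Since [pi] is surjective, the identity says that [ker (pi dtilde)] is the
    preimage of [ker d] ([mem_ker_proj_dtilde]), that [d] and [pi dtilde] have
    the same image ([img_quo_d]), and that the preimage of [im d] is the row
    space of [A] plus [L^s] ([mem_rows_matA_Ls]).

    Both isomorphisms of the last part are then instances of [subquo_iso]: a
    surjective linear map identifies [A / B] with [A' / B'] as soon as [A] and
    [B] are the preimages of [A'] and [B'].  The first one uses it for
    [gamma] ([Tor_iso]), the second one for the projection
    [R^{ms} -> R^{ms} / L^s].  That the rows of [A] plus [L^s] land in
    [ker (pi dtilde)] reflects [d o d = 0], inherited from the resolution. *)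

(** * Kernels, images and subquotients of modules *)

Section Submodules.
Variable R : pzRingType.

Lemma ker_subP (V W : lmodType R) (f : {linear V -> W}) v :
  reflect (f v = 0) (v \in ker_sub f).
Proof. by rewrite unfold_in; apply: eqP. Qed.

Lemma img_subP (V W : lmodType R) (f : {linear V -> W}) w :
  reflect (exists v, f v = w) (w \in img_sub f).
Proof. by apply: (iffP (asboolP _)) => [[v _ <-]|[v <-]]; exists v. Qed.

Lemma proj_surj (V : lmodType R) (A : submodClosed V) q : exists v, proj A v = q.
Proof. by exists (repr q); apply: reprojK. Qed.

Lemma span_sub_reindex (V : lmodType R) (I J : finType) (h : J -> I)
    (g : I -> V) :
  bijective h -> span_sub g =i span_sub (g \o h).
Proof.
move=> hbij; have [h' hK h'K] := hbij => v.
apply/asboolP/asboolP => -[c ->]; last first.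
  exists (c \o h'); rewrite (reindex h) /=; last exact: onW_bij.
  by apply: eq_bigr => i _; rewrite hK.
by exists (c \o h); rewrite (reindex h) //; apply: onW_bij.
Qed.

Lemma eq_span_sub (V : lmodType R) (I : finType) (g g' : I -> V) :
  g =1 g' -> span_sub g =i span_sub g'.
Proof.
move=> gg' v; apply/asboolP/asboolP => -[c ->]; exists c;
  by apply: eq_bigr => i _; rewrite gg'.
Qed.

Lemma img_sub_span n (W : lmodType R) (f : {linear 'rV[R]_n -> W}) :
  img_sub f =i span_sub (fun a => f (delta_mx 0 a)).
Proof.
have fE v : f v = \sum_a v 0 a *: f (delta_mx 0 a).
  rewrite {1}[v]row_sum_delta linear_sum.
  by apply: eq_bigr => a _; rewrite linearZ_LR.
move=> w; apply/img_subP/asboolP => [[v <-]|[c ->]]; first by exists (v 0).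
by exists (\row_a c a); rewrite fE; apply: eq_bigr => a _; rewrite mxE.
Qed.

(** The first isomorphism theorem, in the direction [W -> V / B] and with its
    value on [g v]: a chosen preimage is well defined modulo [B = ker g], and
    [linear phi] follows by computing on elements of the form [g v]. *)
Lemma first_iso (V W : lmodType R) (g : {linear V -> W}) (B : submodClosed V) :
    (forall w, exists v, g v = w) -> (forall v, (v \in B) = (g v == 0)) ->
  exists phi : {linear W -> quomod B},
    bijective phi /\ forall v, phi (g v) = proj B v.
Proof.
move=> gsurj gB.
have ex w : exists v, g v == w by have [v <-] := gsurj w; exists v.
pose phi0 w : quomod B := proj B (xchoose (ex w)).
have phiE v : phi0 (g v) = proj B v.
  by apply/proj_eqP; rewrite gB linearB subr_eq0 (eqP (xchooseP (ex (g v)))).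
have phi_lin : linear phi0.
  move=> a u v; have [u' <-] := gsurj u; have [v' <-] := gsurj v.
  by rewrite -linearP !phiE linearP.
pose phi : {linear W -> quomod B} :=
  HB.pack phi0 (GRing.isLinear.Build R W (quomod B) _ phi0 phi_lin).
exists phi; split; last exact: phiE.
exists (fun q => g (repr q)) => [w|q] /=.
  have [v <-] := gsurj w; rewrite phiE; apply/eqP.
  by rewrite -subr_eq0 -linearB -gB; apply/proj_eqP/reprojK.
by rewrite phiE reprojK.
Qed.

(** Restricting [f] to [A] and projecting gives a surjection
    [A -> A' / B'] with kernel [B], so [first_iso] applies.  [phi] goes from
    the subquotient of the target to that of the source because its effect is
    then described by lifting a class through [f]. *)
Lemma subquo_iso (V W : lmodType R) (f : {linear V -> W})
    (A B : submodClosed V) (A' B' : submodClosed W) :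
    (forall w, exists v, f v = w) ->
    (forall v, (v \in A) = (f v \in A')) ->
    (forall v, (v \in B) = (f v \in B')) ->
  exists phi : {linear subquo A' B' -> subquo A B},
    bijective phi /\
    forall w u, val w = f (val u) -> phi (class_of B' w) = class_of B u.
Proof.
move=> fsurj fA fB.
have fA' (u : submod A) : f (val u) \in A' by rewrite -fA; apply: valP.
pose r0 (u : submod A) : submod A' := Sub (f (val u)) (fA' u).
have r_lin : linear r0.
  by move=> a u v; apply: val_inj; rewrite linearP /r0 !SubK !linearP.
pose r : {linear submod A -> submod A'} :=
  HB.pack r0 (GRing.isLinear.Build R (submod A) (submod A') _ r0 r_lin).
pose g : {linear submod A -> subquo A' B'} := proj (trace_sub B') \o r.
have [||phi [phi_bij phiE]] := @first_iso _ _ g (trace_sub B).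
- move=> q; have [v fv] := fsurj (val (repr q : submod A')).
  have Av : v \in A by rewrite fA fv; apply: valP.
  exists (Sub v Av : submod A); rewrite -[RHS]reprojK /=; congr (proj _ _).
  by apply: val_inj; rewrite !SubK.
- move=> v; apply/idP/eqP => [Bv|].
    rewrite -[RHS](linear0 (proj (trace_sub B'))).
    by apply/proj_eqP; rewrite subr0 /in_mem /= /trace_sub SubK -fB.
  rewrite -[RHS](linear0 (proj (trace_sub B'))) => /proj_eqP.
  by rewrite subr0 /in_mem /= /trace_sub SubK -fB.
exists phi; split=> // w u wu; rewrite [RHS]/class_of -phiE.
congr (phi (proj _ _)).
by apply: val_inj; rewrite SubK.
Qed.
End Submodules.

(** * Block matrices with scalar blocks *)

Section BlockMatrices.
Variables (R : pzRingType) (m : nat).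

(** [R] need not be commutative, so a scalar block acts on row vectors by the
    right scaling [:*]; this is where the right module structure of [R^m]
    enters. *)
Lemma submxrow_mul_scalar_blocks s t (D : 'M[R]_(s, t)) (v : block_rV R m s) l :
  submxrow (v *m \mxblock_(i < s, l' < t) ((D i l')%:M : 'M[R]_m)) l
    = \sum_i submxrow v i :* D i l.
Proof.
rewrite -{1}[v]submxrowK mul_mxrow_mxblock mxrowK; apply: eq_bigr => i _.
by apply/rowP => j; rewrite -diag_const_mx mul_mx_diag !mxE.
Qed.

Lemma Rank_const s (i : 'I_s) (j : 'I_m) :
  @tagnat.Rank s (fun=> m) i j = (j + m * i)%N :> nat.
Proof.
rewrite tagnat.RankEsum addnC; congr (_ + _)%N.
rewrite (big_ord_narrow (ltnW (ltn_ord i))) /= sum_nat_const card_ord.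
exact: mulnC.
Qed.

Lemma row_scalar_blocks s t (D : 'M[R]_(s, t)) (i : 'I_s) (j : 'I_m)
    (a : 'I_(\sum_(i < s) m)) :
    a = (j + m * i)%N :> nat ->
  row a (\mxblock_(i < s, l < t) ((D i l)%:M : 'M[R]_m))
    = \mxrow_(l < t) (D i l *: delta_mx 0 j).
Proof.
move=> aE.
have -> : a = @tagnat.Rank s (fun=> m) i j.
  by apply: ord_inj; rewrite aE Rank_const.
apply/mxrowP => l; rewrite mxrowK.
set B := \mxblock_(_, _) _.
have -> : submxrow (row (tagnat.Rank i j) B) l = row j (submxblock B i l).
  by apply/rowP => b; rewrite !mxE.
rewrite /B mxblockK; apply/rowP => b; rewrite !mxE eqxx /= eq_sym.
by case: eqP => _; rewrite ?mulr1 ?mulr0.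
Qed.

Lemma block_index_bij s :
  bijective (fun ij : 'I_s * 'I_m => @tagnat.Rank s (fun=> m) ij.1 ij.2).
Proof.
exists (fun a : 'I_(\sum_(i < s) m) => (tagnat.sig1 a, tagnat.sig2 a : 'I_m)).
  move=> [i j] /=; congr (_, _); first exact: tagnat.Rank1K.
  by apply: val_inj; rewrite tagnat.Rank2K.
by move=> a; rewrite /= tagnat.sig2K.
Qed.
End BlockMatrices.

(** * The tensored resolution on representatives *)

Section TensoredResolution.
Variables (R : pzRingType) (M : bimodType R) (m : nat).
Variables (P : bimod_presentation M m) (N : lmodType R) (F : free_resolution N).

Lemma gamma_lin_inv s (t : tensor M 'rV[R]_s) :
  gamma (lin_inv (@gamma_bij _ _ _ P s) t) = t.
Proof. exact: lin_invK. Qed.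

(** The computation behind [quo_d_proj], on [R^{ms}]: moving [g_il] across the
    tensor sign turns [p_M(v_i g_il) (x) e_l] into [p_M(v_i) (x) g_il e_l]. *)
Lemma gamma_pre_dtilde k (v : block_rV R m (res_s F k.+1)) :
  gamma_pre P (s := res_s F k) (dtilde m F k v) = tor_map M F k (gamma_pre P v).
Proof.
rewrite !gamma_preE linear_sum /=.
transitivity (\sum_l \sum_i tens (pres_p P (submxrow v i))
                                 (res_d F k i l *: delta_mx 0 l : 'rV_(res_s F k))).
  apply: eq_bigr => l _; rewrite submxrow_mul_scalar_blocks linear_sum tens_suml.
  by apply: eq_bigr => i _; rewrite /= pres_p_right tensA.
rewrite exchange_big; apply: eq_bigr => i _.
rewrite tensor_mapE /= -rowE [row i _]row_sum_delta tens_sumr.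
by apply: eq_bigr => l _; rewrite mxE.
Qed.

Lemma gamma_quo_d k q : gamma (quo_d P F k q) = tor_map M F k (gamma q).
Proof. exact: gamma_lin_inv. Qed.

Lemma quo_d_proj k v :
  quo_d P F k (proj (pres_Ls P (res_s F k.+1)) v) = proj_dtilde P F k v.
Proof.
apply: (bij_inj (@gamma_bij _ _ _ P _)).
by rewrite gamma_quo_d !gamma_proj gamma_pre_dtilde.
Qed.

Lemma mem_ker_proj_dtilde k v :
  (v \in ker_sub (proj_dtilde P F k)) =
  (proj (pres_Ls P (res_s F k.+1)) v \in ker_sub (quo_d P F k)).
Proof. by apply/ker_subP/ker_subP; rewrite quo_d_proj. Qed.

Lemma img_quo_d k : img_sub (quo_d P F k) =i img_sub (proj_dtilde P F k).
Proof.
move=> w; apply/img_subP/img_subP => [[q <-]|[v <-]].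
  have [v <-] := proj_surj q; exists v; exact/esym/quo_d_proj.
exists (proj (pres_Ls P (res_s F k.+1)) v); exact: quo_d_proj.
Qed.

Lemma tor_map_comp k t : tor_map M F k (tor_map M F k.+1 t) = 0.
Proof.
move: t; apply: tensor_ext => [t u|t u|x v].
- by rewrite !linearD.
- by rewrite addr0.
- rewrite /= !tensor_mapE.
  have /ker_subP-> : res_map F k.+1 v \in ker_sub (res_map F k).
    by rewrite res_exact; apply/img_subP; exists v.
  exact: tens0r.
Qed.

Lemma quo_d_comp k q : quo_d P F k (quo_d P F k.+1 q) = 0.
Proof.
apply: (bij_inj (@gamma_bij _ _ _ P _)).
by rewrite !gamma_quo_d tor_map_comp linear0.
Qed.

(** The preimage of [im d] under the projection: [pi v] lies in
    [im d = im (pi dtilde)] when [v] differs by an element of [L^s] from some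
    [dtilde u], that is from a combination of the rows of the matrix. *)
Lemma mem_rows_matA_Ls k v :
  (v \in sum_sub (span_sub (fun a => row a (matA m F k))) (pres_Ls P (res_s F k)))
  = (proj (pres_Ls P (res_s F k)) v \in img_sub (quo_d P F k)).
Proof.
have rowsE : img_sub (dtilde m F k) =i span_sub (fun a => row a (matA m F k)).
  move=> w; rewrite img_sub_span; apply: eq_span_sub => a.
  exact/esym/rowE.
rewrite img_quo_d; apply/asboolP/img_subP => [[a [b [Aa Lb ->]]]|[u uv]].
  move: Aa; rewrite -rowsE => /img_subP[u <-]; exists u.
  by apply/proj_eqP; rewrite opprD addNKr rpredN.
exists (dtilde m F k u), (v - dtilde m F k u); split.
- by rewrite -rowsE; apply/img_subP; exists u.
- exact/proj_eqP/esym.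
- by rewrite subrKC.
Qed.

Lemma Tor_iso k : lmod_iso (Tor M F k.+1)
  (subquo (ker_sub (quo_d P F k)) (img_sub (quo_d P F k.+1))).
Proof.
have gamma_inj s : injective (@gamma _ _ _ P s) := bij_inj (gamma_bij P s).
have [|||phi [phi_bij _]] := @subquo_iso R _ _
  (@gamma _ _ _ P (res_s F k.+1)) (ker_sub (quo_d P F k))
  (img_sub (quo_d P F k.+1)) (tor_cycles M F k.+1) (img_sub (tor_map M F k.+1));
  last by exists phi.
- by move=> t; exists (lin_inv (@gamma_bij _ _ _ P _) t); exact: gamma_lin_inv.
- move=> q; apply/ker_subP/ker_subP => [dq|dq].
    by rewrite -gamma_quo_d dq linear0.
  by apply: gamma_inj; rewrite gamma_quo_d dq linear0.
- move=> q; apply/img_subP/img_subP => [[r <-]|[t tq]].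
    exists (gamma r); exact/esym/gamma_quo_d.
  exists (lin_inv (@gamma_bij _ _ _ P _) t); apply: gamma_inj.
  by rewrite gamma_quo_d gamma_lin_inv.
Qed.
End TensoredResolution.

(* Degrees are shifted by one: [quo_d P F k], [matA F k], ... are the maps and
   matrices numbered [k + 1], so that [k] ranges over all natural numbers. *)
Theorem theorem2p2 (R : nzRingType) (n : nat) (X : left_pbw_ring R n)
    (M : bimodType R) (m : nat) (P : bimod_presentation M m)
    (N : lmodType R) (N_fin_gen : fin_gen N) (F : free_resolution N) (k : nat) :
  [/\
    (* 1 *)
    {subset pres_Ls P (res_s F k.+1) <= ker_sub (proj_dtilde P F k)} /\
    ker_sub (quo_d P F k)
      =i quo_sub (ker_sub (proj_dtilde P F k)) (pres_Ls P (res_s F k.+1)),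
    (* 2 *)
    [/\ img_sub (quo_d P F k) =i img_sub (proj_dtilde P F k),
        img_sub (quo_d P F k)
          =i span_sub (fun ij : 'I_(res_s F k.+1) * 'I_m =>
               proj (pres_Ls P (res_s F k))
                 (\mxrow_(l < res_s F k) (res_d F k ij.1 l *: delta_mx 0 ij.2))) &
        forall (i : 'I_(res_s F k.+1)) (j : 'I_m)
               (a : 'I_(\sum_(i < res_s F k.+1) m)),
          a = (j + m * i)%N :> nat ->
          row a (matA m F k)
            = \mxrow_(l < res_s F k) (res_d F k i l *: delta_mx 0 j)] &
    (* 3 *)
    [/\ {subset img_sub (quo_d P F k.+1) <= ker_sub (quo_d P F k)},
        {subset sum_sub (span_sub (fun a => row a (matA m F k.+1)))
                        (pres_Ls P (res_s F k.+1))
           <= ker_sub (proj_dtilde P F k)},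
        lmod_iso (Tor M F k.+1)
          (subquo (ker_sub (quo_d P F k)) (img_sub (quo_d P F k.+1))) &
        exists phi :
          {linear subquo (ker_sub (quo_d P F k)) (img_sub (quo_d P F k.+1)) ->
                  subquo (ker_sub (proj_dtilde P F k))
                    (sum_sub (span_sub (fun a => row a (matA m F k.+1)))
                             (pres_Ls P (res_s F k.+1)))},
          bijective phi /\
          forall w u, val w = proj (pres_Ls P (res_s F k.+1)) (val u) ->
            phi (class_of _ w) = class_of _ u]].
Proof.
split.
- split.
    move=> v Lv; rewrite mem_ker_proj_dtilde; apply/ker_subP.
    have -> : proj (pres_Ls P (res_s F k.+1)) v = 0.
      by rewrite -(linear0 (proj _)); apply/proj_eqP; rewrite subr0.
    exact: linear0.
  move=> q; have [v <-] := proj_surj q; rewrite -mem_ker_proj_dtilde.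
  apply/idP/asboolP => [Kv|[u Ku uv]]; first by exists v.
  by rewrite mem_ker_proj_dtilde -uv -mem_ker_proj_dtilde.
- split; first exact: img_quo_d; last exact: row_scalar_blocks.
  move=> q; rewrite img_quo_d img_sub_span.
  (* The images of the canonical basis are the classes of the rows, indexed by
     positions; here they are indexed by pairs (block, place in it). *)
  rewrite (span_sub_reindex _ (@block_index_bij m (res_s F k.+1))).
  apply: eq_span_sub => -[i j] /=; congr (proj _ _).
  rewrite -rowE; apply: row_scalar_blocks.
  exact: Rank_const.
- have im_ker : {subset img_sub (quo_d P F k.+1) <= ker_sub (quo_d P F k)}.
    by move=> _ /img_subP[q <-]; apply/ker_subP; apply: quo_d_comp.
  split=> //.
  + by move=> v; rewrite mem_rows_matA_Ls mem_ker_proj_dtilde; apply: im_ker.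
  + exact: Tor_iso.
  + apply: (subquo_iso (f := proj (pres_Ls P (res_s F k.+1)))).
    * exact: proj_surj.
    * exact: mem_ker_proj_dtilde.
    * exact: mem_rows_matA_Ls.
Qed.
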